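(* Let $\mathcal{E}\subset\mathbf{P}^3$ be an elliptic quadric over $\mathbf{F}_q$, i.e. the surface with equation $x_0x_3-Q(x_1,x_2)=0$ for an irreducible quadratic form $Q\in\mathbf{F}_q[x,y]$. For every integer $s$ with $0\le s<q-1$, the evaluation code $C_{\mathcal{E}}(s)$ is permutation equivalent to the extended BCH code $B_0^{ext}(s)$; in particular $C_{\mathcal{E}}(s)$ has parameters $[q^2+1,(s+1)^2,q^2+1-s(q+1)]$.
   Context: For a smooth projective variety $X\subset\mathbf{P}^r$ over $\mathbf{F}_q$ and an integer $s\ge0$, the evaluation code $C_X(s)\subseteq\mathbf{F}_q^n$ is the image of the linear map sending a homogeneous polynomial $f\in\mathbf{F}_q[x_0,\dots,x_r]$ of degree $s$ to $(f(P_1),\dots,f(P_n))$, where $P_1,\dots,P_n$ are the $\mathbf{F}_q$-rational points of $X$ and $f(P)$ is evaluated at the representative of $P$ whose first nonzero coordinate from the left equals $1$. $B^{ext}(s)\subseteq\mathbf{F}_{q^2}^{q^2+1}$ is the $\mathbf{F}_{q^2}$-linear code spanned by the evaluations of the forms $x^{i+qj}y^{(s-i)+q(s-j)}$, $0\le i,j\le s$, at all points of $\mathbf{P}^1(\mathbf{F}_{q^2})$ (each point represented with first nonzero coordinate $1$); $B_0^{ext}(s)=B^{ext}(s)\cap\mathbf{F}_q^{q^2+1}$. Parameters $[n,k,d]$ denote length, dimension, minimum Hamming distance. *)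

(* Defs.v *)
From HB Require Import structures.
From mathcomp Require Import all_boot all_order all_algebra all_field.

Set Implicit Arguments.
Unset Strict Implicit.
Unset Printing Implicit Defensive.

Import GRing.Theory.
Local Open Scope ring_scope.

Definition normalizedb (F : fieldType) (n : nat) (v : 'rV[F]_n) : bool :=
  [exists i : 'I_n, (v 0 i == 1) && [forall j : 'I_n, (j < i)%N ==> (v 0 j == 0)]].

(* P^r(F), each point represented by its normalized representative. *)
Definition ProjPts (F : finFieldType) (r : nat) : finType :=
  {v : 'rV[F]_(r.+1) | normalizedb v}.

Definition coord (F : finFieldType) (r : nat) (P : ProjPts F r) (i : 'I_r.+1) : F :=
  (val P) 0 i.

Definition PtsOf (F : finFieldType) (r : nat) (X : pred (ProjPts F r)) : finType :=
  {P : ProjPts F r | X P}.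

Definition homog_exps (r s : nat) : seq {ffun 'I_r.+1 -> 'I_s.+1} :=
  filter (fun a : {ffun 'I_r.+1 -> 'I_s.+1} =>
            (\sum_(i < r.+1) nat_of_ord (a i) == s)%N)
         (enum {ffun 'I_r.+1 -> 'I_s.+1}).

Definition monoev (F : finFieldType) (r s : nat) (X : pred (ProjPts F r))
    (a : {ffun 'I_r.+1 -> 'I_s.+1}) : {ffun PtsOf X -> F^o} :=
  [ffun P : PtsOf X => \prod_(i < r.+1) coord (val P) i ^+ (a i : nat)].

(* Evaluation code C_X(s): image of the space of degree-s forms, i.e. the
   F-span of the evaluations of the degree-s monomials. *)
Definition evcode (F : finFieldType) (r s : nat) (X : pred (ProjPts F r))
    : {vspace {ffun PtsOf X -> F^o}} :=
  <<[seq monoev X a | a <- homog_exps r s]>>%VS.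

(* Q(x,y) = a x^2 + b x y + c y^2 is an irreducible quadratic form over F:
   nonzero and not a product of two linear forms over F. *)
Definition irreducible_qform (F : fieldType) (a b c : F) : Prop :=
  ~ (a = 0 /\ b = 0 /\ c = 0) /\
  ~ (exists l1 l2 m1 m2 : F,
       [/\ a = l1 * m1, b = l1 * m2 + l2 * m1 & c = l2 * m2]).

Definition quadricE (F : finFieldType) (a b c : F) : pred (ProjPts F 3) :=
  fun P => coord P 0 * coord P 3 -
           (a * coord P 1 ^+ 2 + b * coord P 1 * coord P 2 + c * coord P 2 ^+ 2) == 0.

Definition bext_word (K : finFieldType) (q s : nat) (i j : 'I_s.+1)
    : {ffun ProjPts K 1 -> K^o} :=
  [ffun P : ProjPts K 1 =>
     coord P 0 ^+ (i + q * j)%N * coord P 1 ^+ ((s - i) + q * (s - j))%N].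

Definition Bext (K : finFieldType) (q s : nat) : {vspace {ffun ProjPts K 1 -> K^o}} :=
  <<[seq bext_word K q i j | i <- enum 'I_s.+1, j <- enum 'I_s.+1]>>%VS.

Definition hwt (I : finType) (R : nzRingType) (w : {ffun I -> R}) : nat :=
  #|[set i | w i != 0]|.

Definition is_min_dist (F : fieldType) (I : finType)
    (C : {vspace {ffun I -> F^o}}) (d : nat) : Prop :=
  (exists w, [/\ w \in C, w != 0 & hwt w = d]) /\
  (forall w, w \in C -> w != 0 -> (d <= hwt w)%N).

(* Main.v *)
(* In the right coordinate t = g u + e v on K, an elliptic quadric is the graph
   of the norm: Q(u, v) = t^(q+1).  Over K, the functions u and v span the same
   space as t and t^q, so the linear forms x0, ..., x3 on the quadric span the
   same K-space of functions as the four forms x x^q, x y^q, y x^q, y y^q on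
   P^1(K).  Taking s-fold products, B^ext(s) is the K-span of C_E(s), and an
   F-linear retraction K -> F shows that C_E(s) is exactly its F-valued part
   and that the dimensions agree.  A word of B^ext(s) is the evaluation of a
   binary form of degree s(q+1) <= q^2 whose monomials have distinct exponents;
   this gives the dimension and the lower bound on the weights. *)

Require Import Defs.
From HB Require Import structures.
From mathcomp Require Import all_boot all_order all_algebra all_field.
From mathcomp Require Import ring zify.
Import GRing.Theory Defs.
Local Open Scope ring_scope.

Set Implicit Arguments.
Unset Strict Implicit.
Unset Printing Implicit Defensive.

(** * Frobenius, fixed elements and the norm of a quadratic extension of finite fields *)

Lemma exprDn_card_subfield (F K : finFieldType) (iota : {rmorphism F -> K}) (x y : K) :
  (x + y) ^+ #|F| = x ^+ #|F| + y ^+ #|F|.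
Proof.
apply: exprDn_pchar; have [p p_pr pcharFp] := finPcharP F.
have pcharKp := rmorph_pchar iota pcharFp.
rewrite (eq_pnat _ (pcharf_eq pcharKp)).
(* Seen as a vector space over its prime field, F has order a power of p, and p is also the
   characteristic of K. *)
pose V := pPrimeCharType pcharFp.
have -> : #|F| = #|{: V}%VS| by rewrite card_vspacef.
by rewrite card_vspace card_Fp // pnatX pnat_id.
Qed.

(** Transported to K, X^q - X is still the product of the X - [iota y] with y in F, so it has no
    other roots. *)
Lemma fixed_card_subfield (F K : finFieldType) (iota : {rmorphism F -> K}) (x : K) :
  x ^+ #|F| = x -> exists y : F, x = iota y.
Proof.
move=> xq.
have := congr1 (fun p => (map_poly iota p).[x]) (finField_genPoly F).
rewrite rmorphB /= map_polyXn map_polyX !hornerE xq subrr.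
rewrite rmorph_prod horner_prod => /esym/eqP/prodf_eq0[y _].
rewrite rmorphB /= map_polyX map_polyC !hornerE subr_eq0 => /eqP ->.
by exists y.
Qed.

Lemma root_dvdp_genPoly (K : finFieldType) (p : {poly K}) :
  (1 < size p)%N -> p %| 'X^#|K| - 'X -> exists x, root p x.
Proof.
rewrite finField_genPoly -big_enum => p_gt1 /dvdp_prod_XsubC[m Dp].
move: (eqp_size Dp) p_gt1 => ->; case: mask Dp => [|x r] Dp.
  by rewrite big_nil size_poly1.
by move=> _; exists x; rewrite (eqp_root Dp) root_prod_XsubC mem_head.
Qed.

(** Adjoining a root z of p gives a field of order |F|^(deg p), where z is also a root of
    X^(|F|^(deg p)) - X. An irreducible p not dividing that polynomial would be coprime to it. *)
Lemma irreducible_dvdp_genPoly (F : finFieldType) (p : {poly F}) :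
  irreducible_poly p -> p %| 'X^(#|F| ^ (size p).-1) - 'X.
Proof.
move=> irr_p; have [L dimL [z pz _]] := irredp_FAdjoin irr_p.
have zq : z ^+ (#|F| ^ (size p).-1) = z.
  pose L' := finvect_type L.
  have := @expf_card (FinFieldExtType L') (z : L').
  rewrite -dimL.
  suff -> : #|FinFieldExtType L'| = #|{: L'}%VS| by rewrite card_vspace.
  by apply: eq_card => x; rewrite memvf.
have rz : root (map_poly (GRing.in_alg L) ('X^(#|F| ^ (size p).-1) - 'X)) z.
  by rewrite rmorphB /= map_polyXn map_polyX /root !hornerE zq subrr.
apply: contraLR (rz) => ndvd.
have : coprimep p ('X^(#|F| ^ (size p).-1) - 'X).
  rewrite irreducible_poly_coprime //.
rewrite -(coprimep_map (GRing.in_alg L)) => /coprimep_root; exact.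
Qed.

(** For a nonzero, a^(q-1) = 1, so X^(q+1) - a divides X^(q^2-1) - 1, hence X^|K| - X, which splits
    over K. *)
Lemma norm_surjective (F K : finFieldType) (iota : {rmorphism F -> K}) (a : F) :
  #|K| = (#|F| ^ 2)%N -> exists d : K, d ^+ #|F|.+1 = iota a.
Proof.
move=> cardK; have [->|a0] := eqVneq a 0; first by exists 0; rewrite rmorph0 expr0n.
have q1 : (1 < #|F|)%N := finNzRing_gt1 F.
suff [x] : exists x, root ('X^(#|F|.+1) - (iota a)%:P) x.
  by rewrite /root !hornerE subr_eq0 => /eqP; exists x.
apply: root_dvdp_genPoly; first by rewrite size_XnsubC.
have -> : 'X^#|K| - 'X = 'X * (('X^(#|F|.+1)) ^+ #|F|.-1 - (iota a)%:P ^+ #|F|.-1).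
  rewrite -polyC_exp -rmorphXn /= (_ : a ^+ #|F|.-1 = 1).
    rewrite rmorph1 mulrBr mulr1 -exprM -exprS cardK; congr ('X^_ - _).
    by case: #|F| q1 => // n _ /=; rewrite -mulnn; nia.
  by apply: (mulfI a0); rewrite -exprS prednK ?expf_card ?mulr1 // ltnW.
by rewrite subrXX mulrCA dvdp_mulr.
Qed.

(** * Irreducible binary quadratic forms as norms *)

Lemma irreducible_qform_neq0 (F : fieldType) (a b c : F) :
  irreducible_qform a b c -> a != 0.
Proof.
case=> _ nfact; apply/eqP => a0; apply: nfact; exists 0, 1, b, c.
by split; rewrite ?a0; ring.
Qed.

(** A root r would split off the linear factor x - r y. *)
Lemma irreducible_qform_noroot (F : fieldType) (a b c r : F) :
  irreducible_qform a b c -> a * r ^+ 2 + b * r + c != 0.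
Proof.
case=> _ nfact; apply/eqP => r0; apply: nfact; exists 1, (- r), a, (b + a * r).
by split; [ring|ring|apply/eqP; rewrite -subr_eq0 -r0; apply/eqP; ring].
Qed.

Lemma irreducible_qform_anisotropic (F : fieldType) (a b c u v : F) :
  irreducible_qform a b c ->
  a * u ^+ 2 + b * u * v + c * v ^+ 2 = 0 -> u = 0 /\ v = 0.
Proof.
move=> irr Q0; have a0 := irreducible_qform_neq0 irr.
have [v0|v0] := eqVneq v 0.
  split=> //; apply/eqP; move/eqP: Q0.
  by rewrite v0 !mulr0 expr0n mulr0 !addr0 mulf_eq0 (negPf a0) expf_eq0.
case/negP: (irreducible_qform_noroot (u / v) irr).
suff -> : a * (u / v) ^+ 2 + b * (u / v) + c =
  (a * u ^+ 2 + b * u * v + c * v ^+ 2) / v ^+ 2 by rewrite Q0 mul0r.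
by field.
Qed.

(** The polynomial aX^2 + bX + c has degree 2 and no root in F, so it is irreducible and divides
    X^(q^2) - X. *)
Lemma irreducible_qform_root (F K : finFieldType) (iota : {rmorphism F -> K})
    (a b c : F) :
  #|K| = (#|F| ^ 2)%N -> irreducible_qform a b c ->
  exists x : K, iota a * x ^+ 2 + iota b * x + iota c = 0.
Proof.
move=> cardK irr; have a0 := irreducible_qform_neq0 irr.
pose p : {poly F} := Poly [:: c; b; a].
have sp : size p = 3 by rewrite (PolyK (c := 0)).
have pE (L : nzRingType) (f : {rmorphism F -> L}) x :
  (map_poly f p).[x] = (f a * x + f b) * x + f c.
  by rewrite map_Poly ?rmorph0 // horner_Poly /= mul0r add0r.
have irr_p : irreducible_poly p.
  apply: cubic_irreducible => [|x]; first by rewrite sp.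
  apply: contra (irreducible_qform_noroot (x) irr).
  rewrite /root horner_Poly /= => /eqP <-; apply/eqP; ring.
have [||x] := @root_dvdp_genPoly K (map_poly iota p); first by rewrite size_map_poly sp.
- have := irreducible_dvdp_genPoly irr_p.
  by rewrite -(dvdp_map iota) rmorphB /= map_polyXn map_polyX sp -cardK.
by rewrite /root pE => /eqP <-; exists x; ring.
Qed.

(** With x a root in K and y = x^q its conjugate, Q(u,v) = a(u - xv)(u - yv). If d has norm a, this
    is the norm of d(u - xv). *)
Lemma qform_eq_norm (F K : finFieldType) (iota : {rmorphism F -> K}) (a b c : F) :
  #|K| = (#|F| ^ 2)%N -> irreducible_qform a b c ->
  exists g e : K, forall u v : F,
    (g * iota u + e * iota v) ^+ #|F|.+1 =
    iota (a * u ^+ 2 + b * u * v + c * v ^+ 2).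
Proof.
move=> cardK irr; have a0 := irreducible_qform_neq0 irr.
have [x x0] := irreducible_qform_root iota cardK irr.
have [d dN] := norm_surjective iota a cardK.
pose y := x ^+ #|F|.
have fixF (z : F) : iota z ^+ #|F| = iota z by rewrite -rmorphXn /= expf_card.
have y0 : iota a * y ^+ 2 + iota b * y + iota c = 0.
  rewrite -(fixF a) -(fixF b) -(fixF c) -exprAC -!exprMn.
  by rewrite -!(exprDn_card_subfield iota) x0 expr0n gtn_eqF // ltnW ?finNzRing_gt1.
(* A root fixed by Frobenius would lie in F. As x and y are distinct, subtracting their equations
   and cancelling x - y gives the formulas of Vieta. *)
have yx : x - y != 0.
  rewrite subr_eq0; apply/eqP => /esym/(fixed_card_subfield iota)[r Dx].
  move: x0 (irreducible_qform_noroot (r) irr).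
  by rewrite Dx -!rmorphXn -!rmorphM -!rmorphD => /eqP; rewrite fmorph_eq0 => ->.
have sumE : iota b = - (iota a * (x + y)).
  apply: (mulfI yx); apply/eqP; rewrite -subr_eq0.
  by rewrite -(subrr 0) -{1}x0 -y0; apply/eqP; ring.
have prodE : iota c = iota a * x * y.
  by apply/eqP; rewrite -subr_eq0 -x0 sumE; apply/eqP; ring.
exists d, (- (d * x)) => u v.
have -> : d * iota u + - (d * x) * iota v = d * (iota u + x * - iota v) by ring.
rewrite exprMn dN exprSr exprDn_card_subfield // exprMn -rmorphN !fixF -/y.
rewrite !expr2 !rmorphD !rmorphM sumE prodE rmorphN.
ring.
Qed.

(** * Powers of a space of functions *)

Lemma span_lincomb (R : fieldType) (V : vectType R) (U : seq V) (u : V) :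
  u \in <<U>>%VS -> exists k : 'I_(size U) -> R, u = \sum_i k i *: U`_i.
Proof.
move=> Uu; exists (fun i => vector.coord (in_tuple U) i u).
exact: (coord_span (X := in_tuple U)).
Qed.

Definition mulf (R : fieldType) (T : finType) (f g : {ffun T -> R^o}) : {ffun T -> R^o} :=
  [ffun x => (f x : R) * g x].

(** These s-fold products span the s-th power of the span of [U]. Both codes will be written in this
    form, each with four generators. *)
Fixpoint products (R : fieldType) (T : finType) (s : nat) (U : seq {ffun T -> R^o})
    : seq {ffun T -> R^o} :=
  if s is s'.+1 then [seq mulf u v | u <- U, v <- products s' U]
  else [:: [ffun => (1 : R)]].

Lemma mulf_span (R : fieldType) (T : finType) (U V : seq {ffun T -> R^o}) u v :
  u \in <<U>>%VS -> v \in <<V>>%VS ->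
  mulf u v \in <<[seq mulf x y | x <- U, y <- V]>>%VS.
Proof.
move=> /span_lincomb[k ->] /span_lincomb[l ->].
have -> : mulf (\sum_i k i *: U`_i) (\sum_j l j *: V`_j) =
    \sum_i \sum_j (k i * l j) *: mulf U`_i V`_j.
  apply/ffunP => x; rewrite !ffunE !sum_ffunE mulr_suml; apply: eq_bigr => i _.
  rewrite sum_ffunE mulr_sumr; apply: eq_bigr => j _.
  by rewrite !ffunE /= mulrACA.
apply: memv_suml => i _; apply: memv_suml => j _; apply/rpredZ/memv_span.
by apply: allpairs_f; apply: mem_nth.
Qed.

(** By bilinearity the span of the products depends only on the span of the generators, so
    inclusions need checking in degree 1 only. *)
Lemma products_span_sub (R : fieldType) (T : finType) (s : nat)
    (U V : seq {ffun T -> R^o}) :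
  {subset U <= <<V>>%VS} -> (<<products s U>> <= <<products s V>>)%VS.
Proof.
move=> sUV; apply/span_subvP; elim: s => [|s IHs] w /=; first exact: memv_span.
case/allpairsP=> [[u v] /= [Uu /IHs Vv ->]]; apply: mulf_span => //; exact: sUV.
Qed.

Lemma products_span_foldr (R : fieldType) (T : finType) (U r : seq {ffun T -> R^o}) :
  {subset r <= <<U>>%VS} ->
  foldr (@mulf R T) [ffun => (1 : R)] r \in <<products (size r) U>>%VS.
Proof.
elim: r => [|u r IHr] /= sr; first by rewrite memv_span1.
apply: mulf_span; first by rewrite sr ?mem_head.
by apply: IHr => v rv; rewrite sr // inE rv orbT.
Qed.

Lemma mem_products_prod (R : fieldType) (T : finType) (n s : nat)
    (f : 'I_n -> {ffun T -> R^o}) (a : 'I_n -> nat) :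
  (\sum_i a i = s)%N ->
  [ffun x => \prod_i (f i x : R) ^+ a i] \in products s [seq f i | i <- enum 'I_n].
Proof.
elim: s a => [|s IHs] a sum_a /=.
  rewrite inE; apply/eqP/ffunP => x; rewrite !ffunE big1 // => i _.
  by move/eqP: sum_a; rewrite sum_nat_eq0 => /forallP/(_ i)/eqP ->.
(* A monomial of positive degree has a variable with positive exponent, which is split off. *)
have [k ak] : exists k, (0 < a k)%N.
  apply/existsP; apply: contra_eqT sum_a; rewrite negb_exists => /forallP a0.
  by rewrite big1 // => i _; apply/eqP; rewrite -leqn0 leqNgt a0.
apply/allpairsP; exists (f k, [ffun x => \prod_i (f i x : R) ^+ (a i - (i == k))]).
split=> /=; first by rewrite map_f ?mem_enum.
- apply: IHs; apply/eqP; rewrite -eqSS -sum_a (bigD1 k) //= eqxx -addSn subn1 prednK //.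
  rewrite (bigD1 k (P := predT)) //= eqn_add2l; apply/eqP/eq_bigr => i /negPf ->.
  by rewrite subn0.
apply/ffunP => x; rewrite !ffunE (bigD1 k) //= [in RHS](bigD1 k) //= eqxx subn1.
rewrite mulrA -exprS prednK //; congr (_ * _); apply: eq_bigr => i /negPf ->.
by rewrite subn0.
Qed.

Lemma products_prodP (R : fieldType) (T : finType) (n s : nat)
    (f : 'I_n -> {ffun T -> R^o}) u :
  u \in products s [seq f i | i <- enum 'I_n] ->
  exists2 a : 'I_n -> nat, (\sum_i a i = s)%N & u = [ffun x => \prod_i (f i x : R) ^+ a i].
Proof.
elim: s u => [|s IHs] u /=.
  rewrite inE => /eqP ->; exists (fun=> 0%N); first by rewrite big1.
  by apply/ffunP => x; rewrite !ffunE big1.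
case/allpairsP=> [[u1 v] /= [/mapP[k _ ->] /IHs[a sum_a ->] ->]].
exists (fun i => (i == k) + a i)%N.
  by rewrite big_split /= sum_a (bigD1 k) //= eqxx big1 ?addn0 // => i /negPf ->.
apply/ffunP => x; rewrite !ffunE.
under [in RHS]eq_bigr do rewrite exprD.
rewrite big_split /=; congr (_ * _).
by rewrite (bigD1 k) //= eqxx expr1 big1 ?mulr1 // => i /negPf ->.
Qed.

(** * Both codes as s-th powers *)

Definition coordf (F : finFieldType) (r : nat) (X : pred (ProjPts F r)) (i : 'I_r.+1)
    : {ffun PtsOf X -> F^o} :=
  [ffun P => coord (val P) i].

Lemma evcode_products (F : finFieldType) (r s : nat) (X : pred (ProjPts F r)) :
  evcode s X = <<products s [seq coordf X i | i <- enum 'I_r.+1]>>%VS.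
Proof.
apply/eqP; rewrite eqEsubv; apply/andP; split; apply/span_subvP => u.
  case/mapP=> a; rewrite mem_filter => /andP[/eqP sum_a _] ->; apply: memv_span.
  have -> : monoev X a = [ffun P => \prod_i (coordf X i P : F) ^+ a i].
    by apply/ffunP => P; rewrite !ffunE; apply: eq_bigr => i _; rewrite ffunE.
  exact: mem_products_prod.
case/products_prodP=> a sum_a ->; apply: memv_span; apply/mapP.
(* No exponent of a degree s monomial exceeds s, so [inord] loses nothing. *)
have le_a i : (a i <= s)%N by rewrite -sum_a (bigD1 i) //= leq_addr.
exists [ffun i => inord (a i)].
  rewrite mem_filter mem_enum andbT -[X in _ == X]sum_a; apply/eqP/eq_bigr => i _.
  by rewrite ffunE inordK ?ltnS ?le_a.
apply/ffunP => P; rewrite !ffunE; apply: eq_bigr => i _.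
by rewrite !ffunE inordK ?ltnS ?le_a.
Qed.

Definition bigens (K : finFieldType) (q : nat) : seq {ffun ProjPts K 1 -> K^o} :=
  [seq [ffun P => coord P ij.1 * coord P ij.2 ^+ q] |
    ij <- [:: (0, 0); (0, 1); (1, 0); (1, 1)] : seq ('I_2 * 'I_2)].

Lemma bihomogeneousE (R : comNzRingType) (x y : R) (q i j k l : nat) :
  x ^+ (i + q * j) * y ^+ (k + q * l) = (x ^+ i * y ^+ k) * ((x ^+ q) ^+ j * (y ^+ q) ^+ l).
Proof. by rewrite !exprD !exprM mulrACA. Qed.

(** A generator is a degree s monomial in x, y times a degree s monomial in x^q, y^q. Pairing the
    factors one by one gives s of the four basic forms. *)
Lemma Bext_products (K : finFieldType) (q s : nat) :
  Bext K q s = <<products s (bigens K q)>>%VS.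
Proof.
(* The words with natural number indices and variable degree t, as the induction requires. *)
pose W t i j : {ffun ProjPts K 1 -> K^o} :=
  [ffun P => coord P 0 ^+ (i + q * j) * coord P 1 ^+ ((t - i) + q * (t - j))].
apply/eqP; rewrite eqEsubv; apply/andP; split; apply/span_subvP => u.
  case/allpairsP=> [[i j] /= [_ _ ->]]; apply: memv_span.
  suff H t k l : (k <= t)%N -> (l <= t)%N -> W t k l \in products t (bigens K q).
    by apply: H; rewrite -ltnS.
  elim: t k l => [|t IHt] k l kt lt.
    rewrite inE; apply/eqP/ffunP => P; rewrite !ffunE.
    move: kt lt; rewrite !leqn0 => /eqP -> /eqP ->.
    by rewrite !muln0 !expr0 mulr1.
  (* The factor split off is y when the exponent of x is 0 and x otherwise; the truncated [k.-1]
     serves both cases. *)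
  pose h k : 'I_2 := if k is 0 then 1 else 0.
  have hE (x : 'I_2 -> K) m : (m <= t.+1)%N ->
      x 0 ^+ m * x 1 ^+ (t.+1 - m) = x (h m) * (x 0 ^+ m.-1 * x 1 ^+ (t - m.-1)).
    case: m => [|m] mt; first by rewrite !subn0 exprS mulrCA.
    by rewrite subSS exprS mulrA.
  apply/allpairsP; exists ([ffun P => coord P (h k) * coord P (h l) ^+ q], W t k.-1 l.-1).
  split=> /=.
  - apply/mapP; exists (h k, h l) => //.
    by case: (k) => [|?]; case: (l) => [|?]; rewrite !inE eqxx ?orbT.
  - by apply: IHt; lia.
  - apply/ffunP => P; rewrite !ffunE !bihomogeneousE.
    by rewrite hE // (hE (fun i => coord P i ^+ q)) // mulrACA.
move=> Uu; suff [i [j [it jt ->]]] : exists i j, [/\ (i <= s)%N, (j <= s)%N & u = W s i j].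
  apply: memv_span; apply/allpairsP; exists (inord i, inord j) => /=.
  by split; rewrite ?mem_enum //; apply/ffunP => P; rewrite !ffunE !inordK.
elim: s u Uu => [|s IHs] u.
  rewrite inE => /eqP ->; exists 0%N, 0%N; split=> //; apply/ffunP => P.
  by rewrite !ffunE !muln0 !expr0 mulr1.
case/allpairsP=> [[u1 v] /= [/mapP[[a b] _ ->] /IHs[i [j [it jt ->]]] ->]].
have hE (x : 'I_2 -> K) (d : 'I_2) m : (m <= s)%N ->
    x d * (x 0 ^+ m * x 1 ^+ (s - m)) =
    x 0 ^+ ((d == 0) + m) * x 1 ^+ (s.+1 - ((d == 0) + m)).
  case: d => [[|[|//]] d2] ms /=.
    by rewrite subSS exprS mulrA; congr (x _ * _ * _); apply: val_inj.
  rewrite add0n subSn // exprS mulrCA; congr (_ * (x _ * _)); exact: val_inj.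
exists ((a == 0%R) + i)%N, ((b == 0%R) + j)%N; split; [by case: eqP; lia|by case: eqP; lia|].
apply/ffunP => P; rewrite !ffunE !bihomogeneousE /= mulrACA hE //.
by rewrite (hE (fun i => coord P i ^+ q)).
Qed.

(** * Extension of scalars and descent *)

Definition mapf (F K : fieldType) (iota : F -> K) (T T' : finType) (phi : T' -> T)
    (w : {ffun T -> F^o}) : {ffun T' -> K^o} :=
  [ffun x => (iota (w (phi x)) : K^o)].

Lemma map_products (F K : fieldType) (iota : {rmorphism F -> K}) (T T' : finType)
    (phi : T' -> T) (s : nat) (U : seq {ffun T -> F^o}) :
  [seq mapf iota phi u | u <- products s U] =
  products s [seq mapf iota phi u | u <- U].
Proof.
elim: s => [|s IHs] /=.
  by congr [:: _]; apply/ffunP => x; rewrite !ffunE rmorph1.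
rewrite map_allpairs -IHs allpairs_mapl allpairs_mapr; apply: eq_allpairs => u v.
by apply/ffunP => x; rewrite !ffunE rmorphM.
Qed.

Lemma mapf_lincomb (F K : fieldType) (iota : {rmorphism F -> K}) (T T' : finType)
    (phi : T' -> T) n (k : 'I_n -> F) (U : 'I_n -> {ffun T -> F^o}) :
  mapf iota phi (\sum_i k i *: U i) = \sum_i iota (k i) *: mapf iota phi (U i).
Proof.
apply/ffunP => x; rewrite !ffunE !sum_ffunE rmorph_sum; apply: eq_bigr => i _.
by rewrite !ffunE rmorphM.
Qed.

Lemma mapf_span (F K : fieldType) (iota : {rmorphism F -> K}) (T T' : finType)
    (phi : T' -> T) (U : seq {ffun T -> F^o}) w :
  w \in <<U>>%VS -> mapf iota phi w \in <<[seq mapf iota phi u | u <- U]>>%VS.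
Proof.
move=> /span_lincomb[k ->]; rewrite mapf_lincomb; apply: memv_suml => i _.
by apply/rpredZ/memv_span/map_f/mem_nth.
Qed.

(* Applying an F-linear retraction [lam] of [iota] to the coefficients turns a
   K-linear combination of functions with values in F into an F-linear one. *)
Lemma retract_lincomb (F K : fieldType) (iota : {rmorphism F -> K}) (lam : K -> F)
    (T T' : finType) (phi : T' -> T) (psi : T -> T') n (k : 'I_n -> K)
    (U : 'I_n -> {ffun T -> F^o}) (w : {ffun T -> F^o}) :
  {morph lam : x y / x + y} -> (forall x y, lam (x * iota y) = lam x * y) ->
  lam 1 = 1 -> cancel psi phi ->
  mapf iota phi w = \sum_i k i *: mapf iota phi (U i) ->
  w = \sum_i lam (k i) *: U i.
Proof.
move=> lamD lamZ lam1 psiK Dw; apply/ffunP => x.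
have lam0 : lam 0 = 0 by rewrite -[0 in LHS](mulr0 1) -(rmorph0 iota) lamZ mulr0.
have := congr1 (fun f : {ffun T' -> K^o} => lam (f (psi x))) Dw; rewrite /=.
rewrite sum_ffunE !ffunE psiK -[iota _]mul1r lamZ lam1 mul1r => ->.
rewrite sum_ffunE (big_morph lam lamD lam0); apply: eq_bigr => i _.
by rewrite !ffunE psiK; exact: lamZ.
Qed.

(** Extending scalars creates no new F-valued words, since a K-linear expression of such a word
    retracts to an F-linear one. *)
Lemma mem_map_span (F K : fieldType) (iota : {rmorphism F -> K}) (lam : K -> F)
    (T T' : finType) (phi : T' -> T) (psi : T -> T') (U : seq {ffun T -> F^o}) w :
  {morph lam : x y / x + y} -> (forall x y, lam (x * iota y) = lam x * y) ->
  lam 1 = 1 -> cancel psi phi ->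
  (mapf iota phi w \in <<[seq mapf iota phi u | u <- U]>>%VS) = (w \in <<U>>%VS).
Proof.
move=> lamD lamZ lam1 psiK; apply/idP/idP; last exact: mapf_span.
case/span_lincomb; rewrite size_map => k Dw.
suff -> : w = \sum_i lam (k i) *: U`_i.
  by apply: memv_suml => i _; apply/rpredZ/memv_span/mem_nth.
apply: retract_lincomb lamD lamZ lam1 psiK _; rewrite Dw; apply: eq_bigr => i _.
by rewrite (nth_map 0).
Qed.

(** A K-linear relation with [k i] nonzero can be divided by [k i] and retracted by [lam]; the
    resulting relation over F has i-th coefficient 1. *)
Lemma free_map_mapf (F K : fieldType) (iota : {rmorphism F -> K}) (lam : K -> F)
    (T T' : finType) (phi : T' -> T) (psi : T -> T') (U : seq {ffun T -> F^o}) :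
  {morph lam : x y / x + y} -> (forall x y, lam (x * iota y) = lam x * y) ->
  lam 1 = 1 -> cancel psi phi -> free U -> free [seq mapf iota phi u | u <- U].
Proof.
move=> lamD lamZ lam1 psiK freeU.
apply/(freeP (X := map_tuple (mapf iota phi) (in_tuple U))) => k k0 i.
apply/eqP; apply: contraT => ki; have /eqP[] := oner_neq0 F.
rewrite -lam1 -(mulVf ki).
have /freeP freeU' : free (in_tuple U) by [].
apply: (freeU' (fun j => lam ((k i)^-1 * k j))).
symmetry; apply: retract_lincomb lamD lamZ lam1 psiK _.
transitivity ((k i)^-1 *: (0 : {ffun T' -> K^o})).
  by rewrite scaler0; apply/ffunP => x; rewrite !ffunE rmorph0.
rewrite -[X in _ *: X]k0 scaler_sumr; apply: eq_bigr => j _.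
by rewrite scalerA (nth_map 0).
Qed.

Lemma dim_map_span (F K : fieldType) (iota : {rmorphism F -> K}) (lam : K -> F)
    (T T' : finType) (phi : T' -> T) (psi : T -> T') (U : seq {ffun T -> F^o}) :
  {morph lam : x y / x + y} -> (forall x y, lam (x * iota y) = lam x * y) ->
  lam 1 = 1 -> cancel psi phi ->
  \dim <<[seq mapf iota phi u | u <- U]>> = \dim <<U>>.
Proof.
move=> lamD lamZ lam1 psiK; pose B := vbasis <<U>>%VS.
have UB : <<B>>%VS = <<U>>%VS := span_basis (vbasisP _).
have freeB := free_map_mapf lamD lamZ lam1 psiK (basis_free (vbasisP <<U>>%VS)).
have -> : <<[seq mapf iota phi u | u <- U]>>%VS = <<[seq mapf iota phi u | u <- B]>>%VS.
  apply/eqP; rewrite eqEsubv; apply/andP; split; apply/span_subvP => _ /mapP[u Uu ->].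
    by apply: mapf_span; rewrite UB memv_span.
  by apply: mapf_span; rewrite -UB memv_span.
by move: freeB; rewrite /free => /eqP ->; rewrite size_map size_tuple.
Qed.

(** * Parametrizations of the projective line and of the quadric *)

Lemma ProjPts_eq (F : finFieldType) (r : nat) (P P' : ProjPts F r) :
  coord P =1 coord P' -> P = P'.
Proof. by move=> eqPP'; apply/val_inj/rowP. Qed.

Lemma normalizedb_lead (F : fieldType) (n : nat) (v : 'rV[F]_n) (i : 'I_n) :
  v 0 i = 1 -> (forall j : 'I_n, (j < i)%N -> v 0 j = 0) -> normalizedb v.
Proof.
move=> vi v0; apply/existsP; exists i; rewrite vi eqxx.
by apply/forallP => j; apply/implyP => /v0 ->.
Qed.

Lemma coord0_eq1 (F : finFieldType) (r : nat) (P : ProjPts F r) :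
  coord P 0 != 0 -> coord P 0 = 1.
Proof.
move: (valP P) => /existsP[i /andP[/eqP Pi /forallP P0]] nzP.
suff <- : i = 0 by [].
have := P0 0; apply: contraTeq => i0; rewrite negb_imply nzP andbT lt0n.
by apply: contraNneq i0 => i0; apply/eqP/val_inj.
Qed.

Lemma coord_max_eq1 (F : finFieldType) (r : nat) (P : ProjPts F r) :
  (forall i, i != ord_max -> coord P i = 0) -> coord P ord_max = 1.
Proof.
move: (valP P) => /existsP[i /andP[/eqP Pi _]] P0.
suff <- : i = ord_max by [].
by apply/eqP; apply: contraT => /P0; rewrite /coord Pi => /eqP; rewrite oner_eq0.
Qed.

Definition line_row (K : fieldType) (o : option K) : 'rV[K]_2 :=
  \row_i (if o is Some t then [:: 1; t] else [:: 0; 1])`_i.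

Lemma line_row_normalized (K : fieldType) (o : option K) : normalizedb (line_row o).
Proof.
case: o => [t|]; first by apply: (@normalizedb_lead _ _ _ 0); rewrite ?mxE.
apply: (@normalizedb_lead _ _ _ 1); first by rewrite mxE.
by case=> [[|[|//]] //= j2 _]; rewrite mxE.
Qed.

Definition line_pt (K : finFieldType) (o : option K) : ProjPts K 1 :=
  exist _ (line_row o) (line_row_normalized o).

Definition line_param (K : finFieldType) (P : ProjPts K 1) : option K :=
  if coord P 0 == 0 then None else Some (coord P 1).

Lemma line_ptK (K : finFieldType) : cancel (@line_pt K) (@line_param K).
Proof. by case=> [t|]; rewrite /line_param /coord !mxE /= ?eqxx ?oner_eq0. Qed.

Lemma ord2P (i : 'I_2) : i = 0 \/ i = 1.
Proof. by case: i => [[|[|//]] i2]; [left|right]; apply: val_inj. Qed.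

Lemma line_paramK (K : finFieldType) : cancel (@line_param K) (@line_pt K).
Proof.
move=> P; apply: ProjPts_eq => i; rewrite /line_param.
case: eqP => [P0|/eqP/coord0_eq1 P0]; rewrite {1}/coord mxE.
  case: (ord2P i) => -> //=; rewrite -(@coord_max_eq1 _ _ P) => [|j].
    by congr (coord P _); apply: val_inj.
  by case: (ord2P j) => -> // /eqP[]; apply: val_inj.
by case: (ord2P i) => -> /=.
Qed.

(** The quadric is the graph of Q over the affine plane x0 = 1, plus one point at infinity. *)
Definition quadric_row (F : fieldType) (a b c : F) (o : option (F * F)) : 'rV[F]_4 :=
  \row_i (if o is Some (u, v) then
            [:: 1; u; v; a * u ^+ 2 + b * u * v + c * v ^+ 2]
          else [:: 0; 0; 0; 1])`_i.

Lemma quadric_row_normalized (F : fieldType) (a b c : F) (o : option (F * F)) :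
  normalizedb (quadric_row a b c o).
Proof.
case: o => [[u v]|]; first by apply: (@normalizedb_lead _ _ _ 0); rewrite ?mxE.
apply: (@normalizedb_lead _ _ _ 3); first by rewrite mxE.
by case=> [[|[|[|[|//]]]] //= j4 _]; rewrite mxE.
Qed.

Lemma quadric_row_quadricE (F : finFieldType) (a b c : F) (o : option (F * F)) :
  quadricE a b c (exist _ (quadric_row a b c o) (quadric_row_normalized a b c o)).
Proof.
rewrite /quadricE /coord !mxE /=; case: o => [[u v]|] /=; apply/eqP; ring.
Qed.

Definition quadric_pt (F : finFieldType) (a b c : F) (o : option (F * F)) :
    PtsOf (quadricE a b c) :=
  exist (fun P => quadricE a b c P) _ (quadric_row_quadricE a b c o).

Definition quadric_param (F : finFieldType) (a b c : F) (P : PtsOf (quadricE a b c)) :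
    option (F * F) :=
  if coord (val P) 0 == 0 then None else Some (coord (val P) 1, coord (val P) 2).

Lemma quadric_ptK (F : finFieldType) (a b c : F) :
  cancel (quadric_pt a b c) (@quadric_param F a b c).
Proof.
by case=> [[u v]|]; rewrite /quadric_param /coord !mxE /= ?eqxx ?oner_eq0.
Qed.

Lemma ord4P (i : 'I_4) : [\/ i = 0, i = 1, i = 2 | i = 3].
Proof.
by case: i => [[|[|[|[|//]]]] i4]; [apply: Or41|apply: Or42|apply: Or43|apply: Or44];
  apply: val_inj.
Qed.

(** On x0 = 0 the equation reads Q(x1,x2) = 0, and anisotropy leaves only (0:0:0:1). *)
Lemma quadric_paramK (F : finFieldType) (a b c : F) :
  irreducible_qform a b c -> cancel (@quadric_param F a b c) (quadric_pt a b c).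
Proof.
move=> irr P; apply: val_inj; apply: ProjPts_eq => i; rewrite /quadric_param.
have := valP P; rewrite /quadricE; move: (val P) => {}P.
case: (eqVneq (coord P 0) 0) => [P0|/coord0_eq1 P0] PQ; rewrite {1}/coord mxE.
  move: PQ; rewrite P0 mul0r sub0r oppr_eq0 => /eqP.
  case/(irreducible_qform_anisotropic irr) => P1 P2.
  case: (ord4P i) => -> //=; rewrite -(@coord_max_eq1 _ _ P) => [|j].
    by congr (coord P _); apply: val_inj.
  by case: (ord4P j) => -> // /eqP[]; apply: val_inj.
move: PQ; rewrite P0 mul1r subr_eq0 => /eqP P3.
by case: (ord4P i) => -> /=.
Qed.

(** * Dimension and weights of the extended BCH code over K *)

(** Here [p] dehomogenizes a binary form of degree n whose value at infinity is the coefficient of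
    X^n. A zero at infinity lowers the degree of [p], so there are at most n zeros in all. *)
Lemma hwt_poly_ge (K : finFieldType) (n : nat) (p : {poly K})
    (w : {ffun ProjPts K 1 -> K^o}) :
  p != 0 -> (size p <= n.+1)%N -> (forall t, w (line_pt (Some t)) = p.[t]) ->
  w (line_pt None) = p`_n -> (#|K|.+1 <= hwt w + n)%N.
Proof.
move=> p0 sp wS wN.
have cardP : #|ProjPts K 1| = #|K|.+1.
  rewrite -card_option; apply/esym/(@bij_eq_card _ _ (@line_pt K)).
  exact: Bijective (@line_ptK K) (@line_paramK K).
rewrite -cardP -(cardsC [set i | w i != 0]) leq_add2l.
pose Z := [set t | root p t].
pose N := if p`_n == 0 then [set None : option K] else set0.
have sub : ~: [set i | w i != 0] \subset (@line_pt K) @: (Some @: Z :|: N).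
  apply/subsetP => P; rewrite !inE negbK => wP.
  rewrite -(line_paramK P); apply: imset_f; move: wP; rewrite -{1}(line_paramK P) inE.
  case: (line_param P) => [t|].
    by rewrite wS => pt; rewrite imset_f // inE.
  by rewrite wN /N => ->; rewrite inE eqxx orbT.
apply: leq_trans (subset_leq_card sub) _; apply: leq_trans (leq_imset_card _ _) _.
apply: leq_trans (leq_card_setU _ _) _; apply: leq_trans (leq_add (leq_imset_card _ _) (leqnn _)) _.
have ltZ : (#|Z| < size p)%N.
  rewrite cardE; apply: max_poly_roots; rewrite ?enum_uniq //.
  by apply/allP => t; rewrite mem_enum inE.
rewrite /N; case: eqP => [pn|_]; last by rewrite cards0 addn0 -ltnS (leq_trans ltZ).
rewrite cards1 addn1; apply: leq_trans ltZ _.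
apply/leq_sizeP => j; rewrite leq_eqVlt => /orP[/eqP <- //|nj].
by apply: (leq_sizeP _ _ sp).
Qed.

(** The form with coefficients [c], restricted to x = 1. *)
Definition Bext_poly (K : fieldType) (q s : nat) (c : 'M[K]_s.+1) : {poly K} :=
  \sum_i \sum_j c i j *: 'X^((s - i) + q * (s - j)).

Definition Bext_lincomb (K : finFieldType) (q s : nat) (c : 'M[K]_s.+1)
    : {ffun ProjPts K 1 -> K^o} :=
  \sum_i \sum_j c i j *: bext_word K q i j.

Lemma Bext_lincomb_linear (K : finFieldType) (q s : nat) :
  linear (@Bext_lincomb K q s).
Proof.
move=> k c d; rewrite /Bext_lincomb scaler_sumr -big_split; apply: eq_bigr => i _.
rewrite scaler_sumr -big_split; apply: eq_bigr => j _.
by rewrite !mxE scalerDl scalerA.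
Qed.

HB.instance Definition _ (K : finFieldType) (q s : nat) :=
  GRing.isLinear.Build K 'M[K]_s.+1 {ffun ProjPts K 1 -> K^o} _
    (@Bext_lincomb K q s) (@Bext_lincomb_linear K q s).

Lemma Bext_limg (K : finFieldType) (q s : nat) :
  Bext K q s = limg (linfun (@Bext_lincomb K q s)).
Proof.
apply/eqP; rewrite eqEsubv; apply/andP; split.
  apply/span_subvP => _ /allpairsP[[i j] /= [_ _ ->]].
  apply/memv_imgP; exists (delta_mx i j); rewrite ?memvf // lfunE /= /Bext_lincomb.
  rewrite (bigD1 i) //= (bigD1 j) //= mxE !eqxx scale1r.
  rewrite !big1 ?addr0 // => [k /negPf ki|k /negPf kj].
    by rewrite big1 // => l _; rewrite mxE ki scale0r.
  by rewrite mxE kj andbF scale0r.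
apply/subvP => _ /memv_imgP[c _ ->]; rewrite lfunE /=.
apply: memv_suml => i _; apply: memv_suml => j _; apply/rpredZ/memv_span.
by apply: allpairs_f; rewrite mem_enum.
Qed.

Lemma size_Bext_poly (K : fieldType) (q s : nat) (c : 'M[K]_s.+1) :
  (size (Bext_poly q c) <= (s + q * s).+1)%N.
Proof.
apply: (big_ind (fun p : {poly K} => size p <= (s + q * s).+1)%N) => [|p r sp sr|i _].
- by rewrite size_poly0.
- by apply: leq_trans (size_polyD _ _) _; rewrite geq_max sp.
apply: (big_ind (fun p : {poly K} => size p <= (s + q * s).+1)%N) => [|p r sp sr|j _].
- by rewrite size_poly0.
- by apply: leq_trans (size_polyD _ _) _; rewrite geq_max sp.
apply: leq_trans (size_scale_leq _ _) _; rewrite size_polyXn ltnS.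
by rewrite leq_add ?leq_mul ?leq_subr.
Qed.

(** Since s < q, the exponents are base q expansions with digits s - i and s - j, so no two
    monomials coincide. *)
Lemma coef_Bext_poly (K : fieldType) (q s : nat) (c : 'M[K]_s.+1) (i j : 'I_s.+1) :
  (s < q)%N -> (Bext_poly q c)`_((s - i) + q * (s - j)) = c i j.
Proof.
move=> sq; rewrite coef_sum (bigD1 i) //= coef_sum (bigD1 j) //= coefZ coefXn eqxx mulr1.
have expI (k l : 'I_s.+1) :
    ((s - i) + q * (s - j) == (s - k) + q * (s - l))%N = (k == i) && (l == j).
  have div_e (m n : 'I_s.+1) : (((s - m) + q * (s - n)) %/ q = s - n)%N.
    by rewrite addnC mulnC divnMDl ?divn_small ?addn0; lia.
  apply/eqP/andP => [e|[/eqP -> /eqP ->] //].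
  have e2 : (s - j = s - l)%N by rewrite -(div_e i j) e div_e.
  split; apply/eqP/val_inj => /=; have := ltn_ord i; have := ltn_ord j;
    have := ltn_ord k; have := ltn_ord l; lia.
rewrite !big1 ?addr0 // => [k /negPf ki|l /negPf lj].
  by rewrite coef_sum big1 // => l _; rewrite coefZ coefXn expI ki mulr0.
by rewrite coefZ coefXn expI lj andbF mulr0.
Qed.

Lemma Bext_lincomb_affine (K : finFieldType) (q s : nat) (c : 'M[K]_s.+1) t :
  Bext_lincomb q c (line_pt (Some t)) = (Bext_poly q c).[t].
Proof.
rewrite sum_ffunE horner_sum; apply: eq_bigr => i _.
rewrite sum_ffunE horner_sum; apply: eq_bigr => j _.
by rewrite !ffunE hornerZ hornerXn /coord !mxE /= expr1n mul1r.
Qed.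

(** At (0:1) only the monomial without x survives, namely i = j = 0, which carries the top power of
    y. *)
Lemma Bext_lincomb_infty (K : finFieldType) (q s : nat) (c : 'M[K]_s.+1) :
  (0 < q)%N -> Bext_lincomb q c (line_pt None) = (Bext_poly q c)`_(s + q * s).
Proof.
move=> q0; rewrite sum_ffunE coef_sum; apply: eq_bigr => i _.
rewrite sum_ffunE coef_sum; apply: eq_bigr => j _.
rewrite !ffunE coefZ coefXn /coord !mxE /= expr1n mulr1 expr0n; congr (_ *: (_ %:R)).
have := ltn_ord i; have := ltn_ord j => jt it.
by congr nat_of_bool; apply/eqP/eqP; nia.
Qed.

Lemma hwt_Bext_lincomb_ge (K : finFieldType) (q s : nat) (c : 'M[K]_s.+1) :
  (s < q)%N -> c != 0 -> (#|K|.+1 <= hwt (Bext_lincomb q c) + (s + q * s))%N.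
Proof.
move=> sq c0; apply: (@hwt_poly_ge _ _ (Bext_poly q c)).
- apply: contra_neq c0 => p0; apply/matrixP => i j.
  by rewrite -(coef_Bext_poly c i j sq) p0 coef0 mxE.
- exact: size_Bext_poly.
- exact: Bext_lincomb_affine.
- by apply: Bext_lincomb_infty; lia.
Qed.

Lemma hwt0 (K : finFieldType) (T : finType) : hwt (0 : {ffun T -> K^o}) = 0%N.
Proof. by apply: eq_card0 => x; rewrite !inE ffunE eqxx. Qed.

(** A nonzero matrix in the kernel would give the zero word, yet the weight bound is positive when s
    + qs <= |K|. *)
Lemma dim_Bext (K : finFieldType) (q s : nat) :
  (s < q)%N -> (s + q * s <= #|K|)%N -> \dim (Bext K q s) = (s.+1 ^ 2)%N.
Proof.
move=> sq sK; rewrite Bext_limg limg_dim_eq.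
  by rewrite dimvf dim_matrix.
apply/eqP; rewrite -subv0; apply/subvP => c; rewrite memv_cap memv_ker lfunE memv0 /=.
case/andP=> _ /eqP c0; apply: contraT => /(hwt_Bext_lincomb_ge sq).
by rewrite c0 hwt0; lia.
Qed.

Lemma hwt_Bext_ge (K : finFieldType) (q s : nat) (w : {ffun ProjPts K 1 -> K^o}) :
  (s < q)%N -> w \in Bext K q s -> w != 0 -> (#|K|.+1 <= hwt w + (s + q * s))%N.
Proof.
move=> sq; rewrite Bext_limg => /memv_imgP[c _ ->]; rewrite lfunE /= => w0.
by apply: hwt_Bext_lincomb_ge => //; apply: contra_neq w0 => ->; rewrite linear0.
Qed.

(** * Comparison of the two codes through the norm *)

(** If two pairs have the same image, Q vanishes on their difference, so anisotropy gives
    injectivity; counting gives bijectivity. *)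
Lemma norm_coordinates (F K : finFieldType) (iota : {rmorphism F -> K}) (a b c : F) :
  #|K| = (#|F| ^ 2)%N -> irreducible_qform a b c ->
  exists g e : K, bijective (fun uv : F * F => g * iota uv.1 + e * iota uv.2) /\
    forall u v, (g * iota u + e * iota v) ^+ #|F|.+1 =
      iota (a * u ^+ 2 + b * u * v + c * v ^+ 2).
Proof.
move=> cardK irr; have [g [e normE]] := qform_eq_norm iota cardK irr.
exists g, e; split=> //; apply: inj_card_bij; last by rewrite card_prod cardK mulnn.
move=> [u v] [u' v'] /= /eqP; rewrite -subr_eq0 => /eqP eqL.
suff [/eqP uu /eqP vv] : u - u' = 0 /\ v - v' = 0.
  by apply/eqP; rewrite xpair_eqE -subr_eq0 uu -subr_eq0 vv.
apply: (irreducible_qform_anisotropic irr); apply/eqP.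
rewrite -(fmorph_eq0 iota) -normE expf_eq0 /= -eqL !rmorphB; apply/eqP; ring.
Qed.

(** This is the determinant of the system expressing t and t^q in u and v. If it vanished, g/e would
    be fixed by Frobenius, so g and e would be dependent over F. *)
Lemma norm_coordinates_det (F K : finFieldType) (iota : {rmorphism F -> K}) (g e : K) :
  injective (fun uv : F * F => g * iota uv.1 + e * iota uv.2) ->
  g * e ^+ #|F| - e * g ^+ #|F| != 0.
Proof.
move=> injL; rewrite subr_eq0; apply/eqP => ge.
have e0 : e != 0.
  apply/eqP => e0; have [] // : (0, 1) = (0, 0) :> F * F.
    by apply: injL; rewrite /= e0 !mul0r.
  by move/eqP; rewrite oner_eq0.
have [f Df] : exists f, g / e = iota f.
  apply: fixed_card_subfield; apply: (mulIf e0); apply: (mulIf (expf_neq0 #|F| e0)).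
  by rewrite exprMn exprVn mulrAC mulfVK ?expf_neq0 // mulfVK // mulrC -ge mulrC.
have [] // : (1, - f) = (0, 0) :> F * F.
  apply: injL => /=; rewrite rmorph1 rmorphN -Df rmorph0 !mulr0 addr0 mulr1 mulrN.
  by rewrite mulrC mulfVK ?subrr.
by move/eqP; rewrite oner_eq0.
Qed.

Lemma size_prod_XnsubC (K : fieldType) (n : nat) (r : seq K) :
  (0 < n)%N -> size (\prod_(x <- r) ('X^n - x%:P)) = (n * size r).+1.
Proof.
move=> n0; rewrite size_prod_seq => [|x _].
  under eq_bigr do rewrite size_XnsubC //.
  by rewrite big_const_seq count_predT iter_addn_0 mulSn subSn ?addKn ?leq_addr.
by rewrite -size_poly_eq0 size_XnsubC.
Qed.

(** The map sends (1:t) to the affine point whose pair (u,v) is [L' t], and infinity to infinity;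
    functions on the quadric pull back to the line along it. *)
Definition quadric_to_line (F K : finFieldType) (a b c : F) (L' : K -> F * F)
    (P : ProjPts K 1) : PtsOf (quadricE a b c) :=
  quadric_pt a b c (omap L' (line_param P)).

Lemma quadric_to_line_span (F K : finFieldType) (iota : {rmorphism F -> K})
    (a b c : F) (g e : K) (L' : K -> F * F) (s : nat) :
  cancel (fun uv => g * iota uv.1 + e * iota uv.2) L' ->
  cancel L' (fun uv => g * iota uv.1 + e * iota uv.2) ->
  (forall u v, (g * iota u + e * iota v) ^+ #|F|.+1 =
      iota (a * u ^+ 2 + b * u * v + c * v ^+ 2)) ->
  <<[seq mapf iota (quadric_to_line a b c L') u |
      u <- products s [seq coordf (quadricE a b c) i | i <- enum 'I_4]]>>%VS =
  Bext K #|F| s.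
Proof.
move=> LK L'K normE; have q0 : (0 < #|F|)%N := ltnW (finNzRing_gt1 F).
have det0 := norm_coordinates_det (can_inj LK).
set phi := quadric_to_line a b c L'.
have fixF (z : F) : iota z ^+ #|F| = iota z by rewrite -rmorphXn /= expf_card.
pose C P i := iota (coord (val (phi P)) i).
(* For (x:y) = (1:t) these say that x0 = 1, x3 = t^(q+1), and that u, v combine to t and to t^q; at
   infinity only x3 is nonzero. *)
have [C0 C3 CA CB] : [/\
    forall P, C P 0 = coord P 0 * coord P 0 ^+ #|F|,
    forall P, C P 3 = coord P 1 * coord P 1 ^+ #|F|,
    forall P, g * C P 1 + e * C P 2 = coord P 1 * coord P 0 ^+ #|F| &
    forall P, g ^+ #|F| * C P 1 + e ^+ #|F| * C P 2 = coord P 0 * coord P 1 ^+ #|F|].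
  have expr0q : (0 : K) ^+ #|F| = 0 by rewrite expr0n gtn_eqF.
  split=> P; rewrite -(line_paramK P) /C /phi /quadric_to_line line_ptK;
    case: (line_param P) => [t|] /=; rewrite /coord !mxE /= ?rmorph0 ?rmorph1;
    rewrite ?expr0q ?expr1n ?mulr0 ?mul0r ?mulr1 ?mul1r ?addr0 //;
    move: (L'K t); case: (L' t) => u v /= Dt.
  - exact: rmorph1.
  - by rewrite -normE Dt exprS.
  - exact: Dt.
  - by rewrite -Dt (exprDn_card_subfield iota) !exprMn !fixF.
pose G j k : {ffun ProjPts K 1 -> K^o} := [ffun P => coord P j * coord P k ^+ #|F|].
pose U i : {ffun ProjPts K 1 -> K^o} := mapf iota phi (coordf (quadricE a b c) i).
have UE P i : U i P = C P i by rewrite !ffunE.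
have GE P j k : G j k P = coord P j * coord P k ^+ #|F| by rewrite ffunE.
have U0 : U 0 = G 0 0 by apply/ffunP => P; rewrite UE GE C0.
have U3 : U 3 = G 1 1 by apply/ffunP => P; rewrite UE GE C3.
have GA : G 1 0 = g *: U 1 + e *: U 2.
  by apply/ffunP => P; rewrite !ffunE -CA.
have GB : G 0 1 = g ^+ #|F| *: U 1 + e ^+ #|F| *: U 2.
  by apply/ffunP => P; rewrite !ffunE -CB.
pose d := g * e ^+ #|F| - e * g ^+ #|F|.
(* Cramer's rule, with x and y standing for g^q and e^q, recovers u and v from t and t^q. *)
have cramer1 (u v x y : K) : g * y - e * x != 0 ->
    u = y / (g * y - e * x) * (g * u + e * v) - e / (g * y - e * x) * (x * u + y * v).
  by move=> ?; field.
have cramer2 (u v x y : K) : g * y - e * x != 0 ->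
    v = g / (g * y - e * x) * (x * u + y * v) - x / (g * y - e * x) * (g * u + e * v).
  by move=> ?; field.
have U1 : U 1 = (e ^+ #|F| / d) *: G 1 0 - (e / d) *: G 0 1.
  by apply/ffunP => P; rewrite UE !ffunE -CA -CB; apply: cramer1.
have U2 : U 2 = (g / d) *: G 0 1 - (g ^+ #|F| / d) *: G 1 0.
  by apply/ffunP => P; rewrite UE !ffunE -CA -CB; apply: cramer2.
rewrite map_products Bext_products -map_comp.
apply/eqP; rewrite eqEsubv; apply/andP; split; apply: products_span_sub => w.
  case/mapP=> i _ ->.
  have memG j k : G j k \in <<bigens K #|F|>>%VS.
    apply: memv_span; apply/mapP; exists (j, k) => //.
    by case: (ord2P j) => ->; case: (ord2P k) => ->; rewrite !inE eqxx ?orbT.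
  rewrite -[_ i]/(U i).
  by case: (ord4P i) => ->; rewrite ?(U0, U1, U2, U3) ?rpredB ?rpredZ.
case/mapP=> [[j k] _ ->]; rewrite -[finfun _]/(G j k).
set V := <<_>>%VS; have memU i : U i \in V.
  by apply: memv_span; apply/mapP; exists i; rewrite ?mem_enum.
by case: (ord2P j) => ->; case: (ord2P k) => ->;
  rewrite -?(U0, U3) ?(GA, GB) ?rpredD ?rpredZ.
Qed.

(** * Words of minimum weight and the final comparison *)

Lemma hwt_mapf (F K : fieldType) (iota : {rmorphism F -> K}) (T T' : finType)
    (phi : T' -> T) (w : {ffun T -> F^o}) :
  bijective phi -> hwt (mapf iota phi w) = hwt w.
Proof.
move=> bij_phi; rewrite /hwt -(on_card_preimset (onW_bij _ bij_phi)).
by apply: eq_card => x; rewrite !inE ffunE fmorph_eq0.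
Qed.

(* The word is the product of the plane sections x3 - l x0 for [s] distinct
   nonzero l: they cut out pairwise disjoint conics with q + 1 points each. *)
Lemma evcode_light_word (F K : finFieldType) (iota : {rmorphism F -> K})
    (a b c : F) (s : nat) :
  #|K| = (#|F| ^ 2)%N -> irreducible_qform a b c -> (s < #|F| - 1)%N ->
  exists w, [/\ w \in evcode s (quadricE a b c), w != 0 &
    (hwt w <= #|F| ^ 2 + 1 - s * (#|F| + 1))%N].
Proof.
move=> cardK irr sq; have [g [e [bijL normE]]] := norm_coordinates iota cardK irr.
pose NZ := [seq l <- enum F | l != 0].
have szNZ : size NZ = #|F|.-1.
  rewrite -(cardC1 0) -(card_uniqP (filter_uniq _ (enum_uniq _))).
  by apply: eq_card => x; rewrite mem_filter mem_enum !inE andbT.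
(* [S] holds the s values of l used in the word, [S'] the other nonzero elements of F. *)
pose S := take s NZ; pose S' := drop s NZ.
have szS : size S = s by rewrite size_take szNZ; case: ltnP => //; lia.
have szS' : size S' = (#|F|.-1 - s)%N by rewrite size_drop szNZ.
pose X := quadricE a b c.
pose W := foldr (@mulf F (PtsOf X)) [ffun => (1 : F)]
  [seq coordf X 3 - l *: coordf X 0 | l <- S].
have WE P : W P = \prod_(l <- S) (coord (val P) 3 - l * coord (val P) 0).
  rewrite /W; elim: (S) => [|l r IHr] /=; first by rewrite ffunE big_nil.
  by rewrite big_cons ffunE IHr !ffunE.
have WN : W (quadric_pt a b c None) = 1.
  rewrite WE big1 // => l _.
  by rewrite /coord !mxE /= mulr0 subr0.
exists W; split.
- rewrite evcode_products -[s in products s]szS -(size_map (fun l => coordf X 3 - l *: coordf X 0)).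
  apply: products_span_foldr => _ /mapP[l _ ->].
  by rewrite rpredB ?rpredZ ?memv_span ?map_f ?mem_enum.
- by apply/eqP => W0; have /eqP := WN; rewrite W0 ffunE eq_sym oner_eq0.
pose Q (uv : F * F) := a * uv.1 ^+ 2 + b * uv.1 * uv.2 + c * uv.2 ^+ 2.
pose A := [set uv | Q uv \notin S].
(* At an affine point the word is the product of the Q(u,v) - l, so its support is infinity and the
   points with Q(u,v) outside [S]. *)
have sub : [set P | W P != 0] \subset quadric_pt a b c @: (None |: Some @: A).
  apply/subsetP => P; rewrite inE -(quadric_paramK irr P).
  case: (quadric_param P) => [[u v]|] WP; last by rewrite imset_f // !inE.
  apply: imset_f; rewrite inE imset_f ?orbT // inE.
  apply: contra WP => QS; rewrite WE prodf_seq_eq0; apply/hasP; exists (Q (u, v)) => //.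
  by rewrite /coord !mxE /= mulr1 subrr.
pose L (uv : F * F) := g * iota uv.1 + e * iota uv.2.
have normL uv : L uv ^+ #|F|.+1 = iota (Q uv) by case: uv => u v; exact: normE.
(* For (u,v) in [A], t = [L (u, v)] is 0 or has norm in [S'], so it is a root of [p]. Thus [A] has
   at most 1 + (q+1)(q-1-s) elements; infinity adds one more. *)
pose p := 'X * \prod_(x <- map iota S') ('X^(#|F|.+1) - x%:P).
have p0 : \prod_(x <- map iota S') ('X^(#|F|.+1) - x%:P) != 0.
  by rewrite -size_poly_eq0 size_prod_XnsubC.
have sp : size p = (#|F|.+1 * (#|F|.-1 - s)).+2.
  by rewrite /p mulrC size_mulX // size_prod_XnsubC // size_map szS'.
have ltA : (#|A| < size p)%N.
  rewrite cardE -(size_map L); apply: max_poly_roots.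
  - by rewrite mulf_neq0 ?polyX_eq0.
  - apply/allP => _ /mapP[[u v] nS ->]; rewrite mem_enum inE in nS.
    rewrite /root /p hornerM hornerX mulf_eq0 horner_prod prodf_seq_eq0.
    have [Q0|Q0] := eqVneq (Q (u, v)) 0.
      by have/eqP := normL (u, v); rewrite Q0 rmorph0 expf_eq0 /= => ->.
    apply/orP; right; apply/hasP; exists (iota (Q (u, v))); last first.
      by rewrite !hornerE normL subrr.
    apply: map_f; have : Q (u, v) \in NZ by rewrite mem_filter Q0 mem_enum.
    by rewrite -(cat_take_drop s NZ) mem_cat (negPf nS).
  - by rewrite map_inj_uniq ?enum_uniq //; exact: bij_inj.
apply: leq_trans (subset_leq_card sub) _; apply: leq_trans (leq_imset_card _ _) _.
apply: leq_trans (leq_card_setU _ _) _; rewrite cards1.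
apply: leq_trans (leq_add (leqnn 1) (leq_imset_card _ _)) _.
move: ltA; rewrite sp -mulnn; nia.
Qed.

Theorem theorem3p6 (F K : finFieldType) (iota : {rmorphism F -> K})
    (a b c : F) (s : nat) :
  #|K| = (#|F| ^ 2)%N ->
  irreducible_qform a b c ->
  (s < #|F| - 1)%N ->
  (exists phi : ProjPts K 1 -> PtsOf (quadricE a b c),
      bijective phi /\
      forall w : {ffun PtsOf (quadricE a b c) -> F^o},
        (w \in evcode s (quadricE a b c)) =
        ([ffun P => (iota (w (phi P)) : K^o)] \in Bext K #|F| s)) /\
  [/\ #|PtsOf (quadricE a b c)| = (#|F| ^ 2 + 1)%N,
      \dim (evcode s (quadricE a b c)) = (s.+1 ^ 2)%N &
      is_min_dist (evcode s (quadricE a b c)) (#|F| ^ 2 + 1 - s * (#|F| + 1))%N].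
Proof.
move=> cardK irr sq; have [g [e [[L' LK L'K] normE]]] := norm_coordinates iota cardK irr.
set phi := quadric_to_line a b c L'.
pose L uv := g * iota uv.1 + e * iota uv.2.
pose psi P := line_pt (omap L (@quadric_param F a b c P)).
have phiK : cancel phi psi.
  move=> P; rewrite /phi /psi /quadric_to_line quadric_ptK.
  by rewrite -[RHS]line_paramK; case: line_param => //= t; rewrite /L L'K.
have psiK : cancel psi phi.
  move=> P; rewrite /phi /psi /quadric_to_line line_ptK.
  by rewrite -[RHS](quadric_paramK irr); case: quadric_param => //= uv; rewrite /L LK.
have bij_phi : bijective phi by exists psi.
have L'D x y : L' (x + y) = L' x + L' y.
  apply: (can_inj LK); apply: etrans (L'K _) _.
  by rewrite -[x in LHS]L'K -[y in LHS]L'K /= !rmorphD; ring.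
have L'Z x z : L' (x * iota z) = ((L' x).1 * z, (L' x).2 * z).
  apply: (can_inj LK); apply: etrans (L'K _) _.
  by rewrite -[x in LHS]L'K /= !rmorphM; ring.
(* The first coordinate of k g in the F-basis (g, e) of K is F-linear in k and equals 1 at k = 1,
   which makes it a retraction of [iota]. *)
pose lam k := (L' (k * g)).1.
have lamD : {morph lam : x y / x + y} by move=> x y; rewrite /lam mulrDl L'D.
have lamZ x z : lam (x * iota z) = lam x * z by rewrite /lam mulrAC L'Z.
have lam1 : lam 1 = 1.
  by have := LK (1, 0); rewrite /lam mul1r /= rmorph1 rmorph0 mulr0 addr0 mulr1 => ->.
have span_phi := quadric_to_line_span s LK L'K normE; rewrite -/phi in span_phi.
have memC w : (w \in evcode s (quadricE a b c)) = (mapf iota phi w \in Bext K #|F| s).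
  by rewrite -span_phi evcode_products (mem_map_span _ _ lamD lamZ lam1 psiK).
have sq' : (s < #|F|)%N by lia.
have sK : (s + #|F| * s <= #|K|)%N by rewrite cardK -mulnn; nia.
split; first by exists phi.
split.
- rewrite -(bij_eq_card (f := quadric_pt a b c)) ?card_option ?card_prod ?addn1 //.
  exact: Bijective (@quadric_ptK F a b c) (quadric_paramK irr).
- rewrite evcode_products -(dim_map_span _ lamD lamZ lam1 psiK) span_phi.
  exact: dim_Bext.
(* Transport to the line preserves weights and nonzero words, so the bound over K applies. *)
have lower w : w \in evcode s (quadricE a b c) -> w != 0 ->
    (#|F| ^ 2 + 1 - s * (#|F| + 1) <= hwt w)%N.
  rewrite memC => Cw w0; rewrite -(hwt_mapf iota w bij_phi).
  have : mapf iota phi w != 0.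
    apply: contra_neq w0 => w0; apply/ffunP => P; apply: (fmorph_inj iota).
    have := congr1 (fun f : {ffun _ -> K^o} => f (psi P)) w0.
    by rewrite !ffunE psiK rmorph0.
  move/(hwt_Bext_ge sq' Cw); rewrite cardK; set h := hwt _; lia.
split=> //; have [w [Cw w0 wle]] := evcode_light_word iota cardK irr sq.
by exists w; split=> //; apply/eqP; rewrite eqn_leq wle lower.
Qed.
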